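(* Let $\Gamma$ be a finite simple connected graph and let $\Gamma'$ be an antler graph of $\Gamma$. Then \[\mathrm{pmd}(\Gamma')=\max\{\mathrm{pmd}(\Gamma),\Delta(\Gamma')\}.\]
   Context: $\Delta(\cdot)$ denotes maximum valency (degree). An antler graph of $\Gamma$ is a graph obtained from $\Gamma$ by attaching to every vertex $v$ of $\Gamma$ the root of a rooted tree $T_v$, i.e. identifying the root of $T_v$ with $v$ (the trees $T_v$ are finite, pairwise disjoint and may consist of a single vertex). Equivalently, it is a graph obtained by successively attaching some (possibly no) pendant vertices to the vertices. A matching $M$ (a set of pairwise disjoint edges) of a graph $\Gamma=(V,E)$ is positive if there is $w\colon V\to\mathbb{R}$ with $w(u)+w(v)>0$ for every $uv\in M$ and $w(u)+w(v)<0$ for every $uv\in E\setminus M$. A positive matching decomposition (pmd) of $\Gamma$ is a partition $E=E_1\cup\cdots\cup E_p$ into pairwise disjoint subsets such that $E_i$ is a positive matching of $(V,E\setminus\bigcup_{j<i}E_j)$ for $i=1,\ldots,p$. $\mathrm{pmd}(\Gamma)$ denotes the smallest $p$ for which $\Gamma$ has a pmd with $p$ parts ($0$ if $\Gamma$ has no edges). *)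

(* Defs.v *)
From HB Require Import structures.
From mathcomp Require Import all_boot all_order all_algebra.
From mathcomp Require Import boolp reals.

Set Implicit Arguments.
Unset Strict Implicit.
Unset Printing Implicit Defensive.

Import Order.TTheory GRing.Theory Num.Theory.
Local Open Scope ring_scope.

(* Finite simple graphs (V, E), where E is a set of 2-element subsets of V. *)
Record sgraph := SGraph {
  vertex :> finType;
  edges : {set {set vertex}};
  edges2 : forall A, A \in edges -> #|A| = 2 }.

Definition adj (G : sgraph) : rel G := [rel u v | [set u; v] \in edges G].

Definition valency (G : sgraph) (v : G) : nat := #|[set u : G | adj v u]|.

Definition max_valency (G : sgraph) : nat := (\max_(v : G) valency v)%N.

Definition graph_connected (G : sgraph) : Prop :=
  forall u v : G, connect (@adj G) u v.

(* [ucycle (@adj G)] also holds of [::] and of [:: u; v] for adjacent u, v;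
   these are not cycles of the graph. *)
Definition acyclic (G : sgraph) : Prop :=
  forall c : seq G, ucycle (@adj G) c -> (size c < 3)%N.

Definition tree (G : sgraph) : Prop := graph_connected G /\ acyclic G.

Definition isomorphic (G H : sgraph) : Prop :=
  exists2 f : G -> H, bijective f & forall u v, adj (f u) (f v) = adj u v.

Section Attach.
Variables (G : sgraph) (T : G -> sgraph) (r : forall v, T v).

Definition attach_vertex : finType := {v : G & T v}.

Definition in_tree (v : G) (x : T v) : attach_vertex := existT _ v x.

(* v is identified with the root of its tree *)
Definition in_base (v : G) : attach_vertex := in_tree (r v).

Definition attach_edges : {set {set attach_vertex}} :=
  [set in_base @: A | A : {set G} in edges G]
    :|: \bigcup_(v : G) [set @in_tree v @: A | A : {set T v} in edges (T v)].

Fact attach_edges2 A : A \in attach_edges -> #|A| = 2.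
Proof.
case/setUP=> [/imsetP[B BE ->]|/bigcupP[v _ /imsetP[B BE ->]]].
  by rewrite card_imset ?edges2 // => u v /(congr1 tag).
rewrite card_imset ?edges2 // => x y /eqP.
by rewrite -tag_eqE /tag_eq /= eqxx tagged_asE => /eqP.
Qed.

Definition attach : sgraph := SGraph attach_edges2.

End Attach.

Definition antler_graph (G G' : sgraph) : Prop :=
  exists (T : G -> sgraph) (r : forall v, T v),
    (forall v, tree (T v)) /\ isomorphic (attach r) G'.

Section DeleteEdges.
Variables (G : sgraph) (F : {set {set G}}).

Fact del_edges2 A : A \in edges G :\: F -> #|A| = 2.
Proof. by case/setDP=> AE _; apply: edges2. Qed.

Definition del_edges : sgraph := SGraph del_edges2.

End DeleteEdges.

Definition matching (G : sgraph) (M : {set {set G}}) : Prop :=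
  M \subset edges G /\ trivIset M.

Definition positive_matching (R : realType) (G : sgraph) (M : {set {set G}}) :
    Prop :=
  matching M /\
  exists w : G -> R,
    (forall u v, [set u; v] \in M -> w u + w v > 0) /\
    (forall u v, [set u; v] \in edges G :\: M -> w u + w v < 0).

(* Empty parts are allowed. They do not affect the minimal number of parts,
   since they can be dropped from a decomposition. *)
Definition is_pmd (R : realType) (G : sgraph) (p : nat)
    (D : 'I_p -> {set {set G}}) : Prop :=
  [/\ \bigcup_i D i = edges G,
      forall i j, i != j -> [disjoint D i & D j] &
      forall i : 'I_p, @positive_matching R
        (del_edges (\bigcup_(j < p | (j < i)%N) D j)) (D i)].

Definition has_pmd (R : realType) (G : sgraph) (p : nat) : Prop :=
  exists D : 'I_p -> {set {set G}}, is_pmd R D.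

(* The matchings consisting of a single edge are positive. *)
Fact pmd_exists (R : realType) (G : sgraph) : exists p, `[< has_pmd R G p >].
Proof.
exists #|edges G|; apply/asboolP.
exists (fun i => [set enum_val i]); split=> [|i j ij|i].
- apply/setP=> A; apply/bigcupP/idP=> [[i _ /set1P->]|AE].
    exact: enum_valP.
  by exists (enum_rank_in AE A) => //; rewrite enum_rankK_in // set11.
- rewrite disjoints1 in_set1; apply: contra ij => /eqP/enum_val_inj->.
  exact: eqxx.
- have iE := enum_valP i; set F := \bigcup_(_ | _) _; split; first split.
  + rewrite sub1set in_setD iE andbT; apply/bigcupP=> -[j ji /set1P].
    by move/enum_val_inj=> ij; rewrite ij ltnn in ji.
  + apply/trivIsetP=> A B /set1P-> /set1P->; by rewrite eqxx.
  + exists (fun z => if z \in enum_val i then 1 else - 2%:R); split=> u v.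
      by move=> /set1P <-; rewrite set21 set22 addr_gt0.
    case/setDP=> /setDP[uvE _] /set1P uvi.
    case: ifP => ui; case: ifP => vi.
    * case: uvi; apply/eqP; rewrite eqEcard (@edges2 G _ uvE) (@edges2 G _ iE) andbT.
      by apply/subsetP=> z /set2P[]->.
    * by rewrite subr_lt0 ltr1n.
    * by rewrite addrC subr_lt0 ltr1n.
    * by rewrite -opprD oppr_lt0 addr_gt0.
Qed.

Definition pmd (R : realType) (G : sgraph) : nat := ex_minn (pmd_exists R G).

(* Main.v *)
Require Import Defs.
From mathcomp Require Import all_boot all_order all_algebra.
From mathcomp Require Import boolp reals.

(** The two lower bounds hold because a decomposition of [G'] restricts to the
    subgraph [G], and because a matching contains at most one edge at each
    vertex, so that the edges at a vertex lie in different parts.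

    For the upper bound, let [p] be at least [pmd G] and the maximum valency of
    [G'], and build [G'] from [G] by adding pendant vertices one at a time,
    starting from a decomposition of [G] into [p] parts.  When [x] is attached
    to [v], fewer than [p] edges are already present at [v], so some part [i]
    has no edge at [v]; the new edge [vx] goes there (lemma
    [colorable_pendant]).  It stays a matching, and since [vx] is the only edge
    at [x], the weight of [x] can be chosen freely: at stage [i] large enough
    to make [vx] positive, at the earlier stages low enough to make it
    negative, while at the later stages [vx] has been deleted.

    Decompositions are handled as colourings [c] of the edges by [0, ..., p-1],
    [c A] being the index of the part that contains [A]; they can be pulled
    back along vertex maps ([colorable_pullback]), which covers isomorphisms,
    the passage to a subgraph, and the copy of [G] inside the antler graph.
    That trees arise by adding pendant vertices is the induction principle
    [tree_ind]. *)

Set Implicit Arguments.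
Unset Strict Implicit.
Unset Printing Implicit Defensive.

Import Order.TTheory GRing.Theory Num.Theory.

(** * Decompositions as colourings *)

(** Edges of colour less than [i] are unconstrained by the weight of stage [i]:
    they have been deleted by then. *)
Definition pos_coloring (R : realType) (T : finType) (F : {set {set T}})
    (p : nat) (c : {set T} -> nat) : Prop :=
  [/\ {in F, forall A, c A < p},
      {in F &, forall A B, A != B -> c A = c B -> [disjoint A & B]} &
      forall i, i < p -> exists w : T -> R, forall u v, [set u; v] \in F ->
        (c [set u; v] = i -> (0 < w u + w v)%R) /\
        (i < c [set u; v] -> (w u + w v < 0)%R)].

Definition colorable R (T : finType) (F : {set {set T}}) p : Prop :=
  exists c, @pos_coloring R T F p c.

Lemma has_pmdP (R : realType) (G : sgraph) p :
  has_pmd R G p <-> colorable R (edges G) p.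
Proof.
split=> [[D [covD disD posD]]|[c [c_lt c_dis c_pos]]].
- have memD A i j : A \in D i -> A \in D j -> i = j.
    move=> Ai Aj; apply/eqP/negPn/negP => /disD.
    by move/disjointFr/(_ Ai); rewrite Aj.
  pose c A := if [pick i | A \in D i] is Some i then val i else p.
  have cE A i : A \in D i -> c A = i.
    rewrite /c => Ai; case: pickP => [j /memD/(_ Ai)-> //|/(_ i)].
    by rewrite Ai.
  have exD A : A \in edges G -> exists i, A \in D i.
    by rewrite -covD => /bigcupP[i _ Ai]; exists i.
  exists c; split.
  + by move=> A /exD[i Ai]; rewrite (cE A i).
  + move=> A B /exD[i Ai] /exD[j Bj] AB.
    rewrite (cE A i) // (cE B j) // => /val_inj ij; subst j.
    have [[_ /trivIsetP tD] _] := posD i.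
    exact: tD.
  + move=> i ip; have [_ [w [wpos wneg]]] := posD (Ordinal ip).
    exists w => u v /[dup] uvE /exD[j uvj]; rewrite (cE _ j) //; split.
      by move=> ji; apply: wpos; rewrite (_ : Ordinal ip = j) //; apply: val_inj.
    move=> ij; apply: wneg; rewrite /= !in_setD uvE andbT; apply/andP; split.
      by apply/negP => /memD/(_ uvj) ji; rewrite -ji /= ltnn in ij.
    apply/bigcupP => -[k ki /memD/(_ uvj) kj]; subst k.
    by have := ltn_trans ij ki; rewrite /= ltnn.
- exists (fun i : 'I_p => [set A in edges G | c A == i]); split.
  + apply/setP => A; apply/bigcupP/idP => [[i _]|AE].
      by rewrite inE => /andP[].
    by exists (Ordinal (c_lt _ AE)) => //; rewrite inE AE /=.
  + move=> i j ij; rewrite -setI_eq0; apply/eqP/setP => A; rewrite !inE.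
    apply/negbTE; apply: contra ij => /andP[/andP[_ /eqP ci] /andP[_ /eqP cj]].
    by apply/eqP/val_inj; rewrite /= -ci -cj.
  + move=> i; split; first split.
    * apply/subsetP => A; rewrite inE => /andP[AE /eqP ci].
      rewrite /= in_setD AE andbT; apply/bigcupP => -[j ji].
      by rewrite inE AE ci /= => /eqP ij; rewrite ij ltnn in ji.
    * apply/trivIsetP => A B; rewrite !inE => /andP[AE /eqP ci].
      by move=> /andP[BE /eqP cj] AB; apply: c_dis => //; rewrite ci cj.
    * have [w wP] := c_pos i (ltn_ord i); exists w; split => u v.
        by rewrite inE => /andP[/wP[wp _] /eqP/wp].
      rewrite /= !in_setD => /andP[ni /andP[nj uvE]]; apply: (wP u v uvE).2.
      rewrite ltnNge leq_eqVlt negb_or; apply/andP; split.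
        by move: ni; rewrite inE uvE.
      apply: contra nj => ci; apply/bigcupP.
      by exists (Ordinal (c_lt _ uvE)); rewrite // inE uvE /=.
Qed.

Lemma colorableW R (T : finType) (F : {set {set T}}) p q :
  p <= q -> colorable R F p -> colorable R F q.
Proof.
move=> pq [c [c_lt c_dis c_pos]]; exists c; split=> // [A AF|i iq].
  exact: leq_trans (c_lt A AF) pq.
have [/c_pos//|pi] := ltnP i p.
exists (fun=> 0%R) => u v /c_lt lp; have ci := leq_trans lp pi.
by split=> [ci'|/(ltn_trans ci)]; [rewrite ci' ltnn in ci | rewrite ltnn].
Qed.

Lemma pmd_leP (R : realType) (G : sgraph) p :
  pmd R G <= p <-> colorable R (edges G) p.
Proof.
rewrite /pmd; case: ex_minnP => q /asboolP/has_pmdP colq minq; split=> [qp|].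
  exact: colorableW qp colq.
by move=> colp; apply: minq; apply/asboolP/has_pmdP.
Qed.

Lemma imset_pair (S T : finType) (f : S -> T) x y :
  f @: [set x; y] = [set f x; f y].
Proof. by rewrite imsetU1 imset_set1. Qed.

(** [f] itself need not be injective: the weights are composed with [f], and
    sets with disjoint images are disjoint. *)
Lemma colorable_pullback R (S T : finType) (f : S -> T)
    (F : {set {set S}}) (F' : {set {set T}}) p :
  {in F &, injective (fun A : {set S} => f @: A)} ->
  {in F, forall A : {set S}, f @: A \in F'} ->
  colorable R F' p -> colorable R F p.
Proof.
move=> f_inj fF [c [c_lt c_dis c_pos]]; exists (fun A : {set S} => c (f @: A)).
split.
- by move=> A /fF/c_lt.
- move=> A B AF BF AB cAB.
  have fAB : f @: A != f @: B by apply: contra AB => /eqP/f_inj->.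
  have dis := c_dis _ _ (fF _ AF) (fF _ BF) fAB cAB.
  rewrite disjoint_subset; apply/subsetP => x xA.
  rewrite !inE; apply/negP => xB.
  by have := disjointFr dis (imset_f f xA); rewrite imset_f.
- move=> i /c_pos[w wP]; exists (w \o f) => u v /fF.
  by rewrite imset_pair => /wP.
Qed.

(** * Edges at a vertex *)

Definition star (T : finType) (F : {set {set T}}) (v : T) : {set {set T}} :=
  [set A in F | v \in A].

Lemma edgeP (G : sgraph) (A : {set G}) :
  A \in edges G -> exists u v, [/\ u != v, A = [set u; v] & adj u v].
Proof.
move=> AE; have /eqP/cards2P[u [v [uv Auv]]] := edges2 AE.
by exists u, v; split=> //; move: AE; rewrite Auv.
Qed.

Lemma adj_sym (G : sgraph) : symmetric (@adj G).
Proof. by move=> u v; rewrite /adj /= setUC. Qed.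

Lemma adj_neq (G : sgraph) (u v : G) : adj u v -> u != v.
Proof.
move=> /edges2; apply: contra_eq_neq => ->.
by rewrite setUid cards1.
Qed.

Lemma card_star (G : sgraph) (v : G) : #|star (edges G) v| = valency v.
Proof.
have injv : injective (fun u : G => [set v; u]).
  move=> a b /setP ab; have := ab a; have := ab b; rewrite !inE !eqxx !orbT.
  by case: (eqVneq b v) => [->|_ /eqP //] _; case: eqP.
rewrite /valency -(card_imset _ injv); apply: eq_card => A.
apply/idP/imsetP => [|[u]]; rewrite !inE.
  case/andP => /[dup] AE /edgeP[a [b [_ AE' ab]]]; rewrite AE' !inE.
  case/orP => /eqP->; [by exists b; rewrite // inE|].
  by exists a; rewrite ?inE 1?setUC // adj_sym.
by move=> uv ->; rewrite !inE eqxx andbT.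
Qed.

Lemma valency_le_max (G : sgraph) (v : G) : valency v <= max_valency G.
Proof. exact: (leq_bigmax v). Qed.

(** The colours of the edges at a vertex are distinct. *)
Lemma max_valency_le_colors R (G : sgraph) p :
  colorable R (edges G) p -> max_valency G <= p.
Proof.
move=> [c [c_lt c_dis _]]; apply/bigmax_leqP => v _.
rewrite -card_star cardE -(size_map c) -(size_iota 0 p).
apply: uniq_leq_size.
  rewrite map_inj_in_uniq ?enum_uniq // => A B.
  rewrite !mem_enum !inE => /andP[AE vA] /andP[BE vB] cAB.
  apply/eqP/negPn/negP => AB; have := c_dis A B AE BE AB cAB.
  by move/disjointFr/(_ vA); rewrite vB.
move=> i /mapP[A]; rewrite mem_enum inE => /andP[/c_lt cA _ ->].
by rewrite mem_iota.
Qed.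

(** * Attaching a pendant vertex *)

Lemma colorable_pendant (R : realType) (T : finType) (F : {set {set T}}) p v x :
  v != x -> star F x = set0 -> #|star F v| < p ->
  colorable R F p -> colorable R ([set v; x] |: F) p.
Proof.
move=> vx xF degv [c [c_lt c_dis c_pos]].
have noF B : B \in F -> x \notin B.
  move=> BF; apply/negP => xB; have : B \in star F x by rewrite inE BF.
  by rewrite xF inE.
have /hasP[i] : has (fun i => i \notin map c (enum (star F v))) (iota 0 p).
  rewrite has_predC; apply/negP => /allP /= sub.
  have := uniq_leq_size (iota_uniq 0 p) sub.
  by rewrite size_iota size_map -cardE leqNgt degv.
rewrite mem_iota /= add0n => ip /mapP i_free.
have iF B : B \in F -> v \in B -> c B <> i.
  by move=> BF vB cB; apply: i_free; exists B; rewrite // mem_enum inE BF.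
have vxF : [set v; x] \notin F.
  by apply/negP => /noF; rewrite !inE eqxx orbT.
have neF B : B \in F -> (B == [set v; x]) = false.
  by move=> BF; apply: contraNF vxF => /eqP <-.
have dis B : B \in F -> c B = i -> [disjoint [set v; x] & B].
  move=> BF cB; rewrite disjoint_subset; apply/subsetP => y.
  by case/set2P=> ->; rewrite inE ?noF //; apply/negP => vB; apply: iF cB.
exists (fun B => if B == [set v; x] then i else c B); split.
- by move=> B /setU1P[->|BF]; rewrite ?eqxx // neF // c_lt.
- move=> A B /setU1P[->|AF] /setU1P[->|BF]; rewrite ?eqxx ?neF //.
  + by move=> _ /esym/dis; apply.
  + by move=> _ /dis; rewrite disjoint_sym; apply.
  + exact: c_dis.
- move=> j /c_pos[w wP].
  pose t : R := (if j == i then 1 - w v else - 1 - w v)%R.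
  pose w' y := if y == x then t else w y.
  have w'vx : (w' v + w' x = if j == i then 1 else -1)%R.
    rewrite /w' eqxx (negbTE vx) /t.
    by case: (j == i); rewrite addrC subrK.
  have new : (i = j -> (0 < w' v + w' x)%R) /\ (j < i -> (w' v + w' x < 0)%R).
    rewrite w'vx; split=> [->|ji]; first by rewrite eqxx ltr01.
    by rewrite (ltn_eqF ji) ltrN10.
  exists w' => a b /setU1P[abE|abF]; last first.
    have := noF _ abF; rewrite neF // !inE negb_or /w' ![x == _]eq_sym.
    by case/andP => /negbTE-> /negbTE->; apply: wP.
  rewrite abE eqxx.
  have : a != b.
    apply: contra_eq_neq (congr1 (fun A : {set T} => #|A|) abE) => ->.
    by rewrite setUid cards1 cards2 vx.
  have : a \in [set v; x] by rewrite -abE set21.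
  have : b \in [set v; x] by rewrite -abE set22.
  by case/set2P=> -> /set2P[]->; rewrite ?eqxx // [(w' x + _)%R]addrC.
Qed.

(** * Trees grow by pendant vertices *)

(** The visited set [S] is kept connected within itself.  A vertex [x] outside
    [S] with two neighbours in [S] would close a cycle with a path of [S]
    between them, hence a neighbour of [S] is pendant when it is added. *)
Lemma tree_ind (G : sgraph) (r : G) (P : {set G} -> Prop) :
  tree G -> P [set r] ->
  (forall (S : {set G}) u x, r \in S -> u \in S -> x \notin S -> adj u x ->
     (forall y, y \in S -> adj y x -> y = u) -> P S -> P (x |: S)) ->
  P setT.
Proof.
move=> [connG acycG] Pr PS.
pose eS (S : {set G}) : rel G := [rel a b | [&& a \in S, b \in S & adj a b]].
have eS_sym S : connect_sym (eS S).
  by apply: sym_connect_sym => a b; rewrite /eS /= adj_sym andbCA.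
have grow n : forall S : {set G}, #|~: S| = n -> r \in S -> P S ->
    {in S, forall a, connect (eS S) r a} -> P setT.
  elim: n => [|n IHn] S cardS rS PS' connS.
    have /eqP := cardS; rewrite cards_eq0 => /eqP SC0.
    by rewrite -setC0 -SC0 setCK.
  have [z zS] : exists z, z \notin S.
    have /card_gt0P[z] : 0 < #|~: S| by rewrite cardS.
    by rewrite inE; exists z.
  have [u [x [uS xS ux]]] : exists u x, [/\ u \in S, x \notin S & adj u x].
    have /connectP[q] := connG r z; move: (r) rS.
    elim: q => [|y q IHq] a aS /=.
      by move=> _ zE; rewrite zE aS in zS.
    case/andP => ay yq zE; have [yS|yS] := boolP (y \in S).
      exact: IHq yS yq zE.
    by exists a, y.
  have xuniq y : y \in S -> adj y x -> y = u.
    move=> yS yx; apply/eqP/negPn/negP => yu.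
    have : connect (eS S) u y.
      by apply: connect_trans (connS y yS); rewrite eS_sym connS.
    case/connectP => q uq yE.
    have {q uq yE} [q [uq yE uniq_q]] :
        exists q, [/\ path (eS S) u q, y = last u q & uniq (u :: q)].
      by case/shortenP: uq yE => q' ? ? _ ->; exists q'.
    have qS : {subset u :: q <= S}.
      move: (u) uS uq; elim: q {yE uniq_q} => [|b q IHq] a aS /=.
        by move=> _ ?; rewrite inE => /eqP->.
      by case/andP => /and3P[_ bS _] bq ?; rewrite inE => /predU1P[->|/IHq->].
    have adjq : path (@adj G) u q.
      by apply: sub_path uq => a b /and3P[].
    have /acycG : ucycle (@adj G) (x :: u :: q).
      rewrite /ucycle /= -/(uniq (u :: q)) uniq_q andbT rcons_path.
      rewrite adj_sym ux adjq -yE yx /=.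
      by apply: contra xS => /qS.
    by case: q yE {uq uniq_q qS adjq} yu => // ->; rewrite eqxx.
  apply: (IHn (x |: S)) => [||| a].
  - have : #|~: S| = #|x |: ~: (x |: S)|.
      apply: eq_card => a; rewrite !inE negb_or.
      by case: (eqVneq a x) => [->|].
    by rewrite cardS cardsU1 !inE eqxx /= => -[].
  - by rewrite !inE rS orbT.
  - exact: PS xuniq PS'.
  - have sub : subrel (connect (eS S)) (connect (eS (x |: S))).
      apply: connect_sub => a' b /and3P[aS bS ab]; apply: connect1.
      by rewrite /eS /= !inE aS bS ab !orbT.
    case/setU1P => [->|/connS/sub //].
    apply: connect_trans (sub _ _ (connS u uS)) (connect1 _).
    by rewrite /eS /= !inE eqxx uS ux orbT.
apply: (grow #|~: [set r]| [set r]) => // [|a /set1P->]; first exact: set11.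
exact: connect0.
Qed.

(** Each vertex reached by [tree_ind] is pendant when it is added, so that
    [colorable_pendant] applies.  The fixed set [E] stands for the edges of the
    final graph: its valencies bound those of all intermediate graphs. *)
Lemma colorable_tree R (X : finType) (F E : {set {set X}}) (T : sgraph) (r : T)
    (f : T -> X) p :
  tree T -> injective f -> (forall x, x != r -> star F (f x) = set0) ->
  F \subset E -> [set f @: A | A : {set T} in edges T] \subset E ->
  (forall v, #|star E v| <= p) ->
  colorable R F p ->
  colorable R (F :|: [set f @: A | A : {set T} in edges T]) p.
Proof.
move=> treeT f_inj rootF FE TE degE colF.
pose FS (S : {set T}) : {set {set X}} :=
  F :|: [set f @: A | A : {set T} in edges T & A \subset S].
suff: colorable R (FS setT) p.
  suff -> : FS setT = F :|: [set f @: A | A : {set T} in edges T] by [].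
  congr setU; apply/setP => B; apply/imsetP/imsetP => -[A AE ->]; exists A => //.
    by move: AE; rewrite inE => /andP[].
  by rewrite inE AE subsetT.
apply: (tree_ind (r := r) (P := fun S => colorable R (FS S) p)) => //.
  suff FS1 : FS [set r] = F by rewrite FS1.
  apply/setP => B; rewrite in_setU; apply/orP/idP => [[//|/imsetP[A]]|].
    rewrite inE => /andP[/edges2 A2 /subset_leq_card].
    by rewrite A2 cards1.
  by left.
move=> S u x rS uS xS ux xuniq colS.
have FS_E : FS S \subset E.
  rewrite subUset FE; apply: subset_trans TE; apply: imsetS.
  by apply/subsetP => A; rewrite inE => /andP[].
have newE : [set f u; f x] \in E.
  apply: (subsetP TE); rewrite -imset_pair; exact: imset_f.
have x_new : star (FS S) (f x) = set0.
  apply/setP => B; rewrite in_set0 inE.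
  apply/negP => /andP[BFS xB]; case/setUP: BFS => [BF|/imsetP[A]].
    have xr : x != r by apply: contra xS => /eqP->.
    by have := rootF x xr => /setP/(_ B); rewrite !inE BF xB.
  rewrite inE => /andP[_ /subsetP AS] BE.
  move: xB; rewrite BE => /imsetP[y /AS yS /f_inj xy].
  by rewrite xy yS in xS.
have newN : [set f u; f x] \notin FS S.
  apply/negP => nF; have := x_new => /setP/(_ [set f u; f x]).
  by rewrite !inE eqxx orbT andbT => H; rewrite inE H in nF.
have -> : FS (x |: S) = [set f u; f x] |: FS S.
  rewrite /FS setUCA; congr setU; apply/setP => B.
  apply/imsetP/setU1P => [[A]|[->|/imsetP[A]]].
  - rewrite inE => /andP[AE /subsetP AS] BE.
    have [xA|xA] := boolP (x \in A); last first.
      right; apply/imsetP; exists A; rewrite // inE AE; apply/subsetP => a aA.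
      by have /setU1P[ax|//] := AS a aA; rewrite -ax aA in xA.
    left; rewrite BE; have [a [b [ab Aab adjab]]] := edgeP AE.
    rewrite -imset_pair; congr (_ @: _).
    move: xA AS; rewrite Aab => /set2P[xE|xE] AS; subst x.
      have /setU1P[ba|bS] := AS b (set22 _ _); first by rewrite ba eqxx in ab.
      by rewrite (xuniq b) 1?setUC // adj_sym.
    have /setU1P[ba|aS] := AS a (set21 _ _); first by rewrite ba eqxx in ab.
    by rewrite (xuniq a).
  - exists [set u; x]; last by rewrite imset_pair.
    rewrite inE; apply/andP; split; first exact: ux.
    by apply/subsetP => a /set2P[]->; rewrite !inE ?eqxx ?uS ?orbT.
  - rewrite inE => /andP[AE AS] BE; exists A; rewrite // inE AE.
    exact: subset_trans AS (subsetUr _ _).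
apply: colorable_pendant => //.
  by rewrite (inj_eq f_inj) adj_neq.
apply: leq_trans (degE (f u)); apply: proper_card; apply/properP; split.
  by apply/subsetP => B; rewrite !inE -in_setU => /andP[/(subsetP FS_E)-> ->].
exists [set f u; f x]; first by rewrite !inE newE eqxx.
by rewrite inE negb_and newN.
Qed.

(** * Antler graphs *)

Section Attach.
Variables (R : realType) (G : sgraph) (T : G -> sgraph) (r : forall v, T v).

Lemma in_tree_inj v : injective (@in_tree G T v).
Proof. by move=> x y /eqP; rewrite -tag_eqE /tag_eq /= eqxx tagged_asE => /eqP. Qed.

Lemma in_base_inj : injective (in_base r).
Proof. by move=> u v /(congr1 tag). Qed.

Lemma colorable_attach p :
  (forall v, tree (T v)) -> max_valency (attach r) <= p ->
  colorable R (edges G) p -> colorable R (edges (attach r)) p.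
Proof.
move=> treeT degp colG.
pose E := edges (attach r).
pose base : {set {set attach_vertex T}} :=
  [set in_base r @: A | A : {set G} in edges G].
pose tr v : {set {set attach_vertex T}} :=
  [set @in_tree G T v @: A | A : {set T v} in edges (T v)].
have degE (v : attach_vertex T) : #|star E v| <= p.
  apply: leq_trans degp; rewrite (@card_star (attach r) v).
  exact: valency_le_max.
have baseE : base \subset E by exact: subsetUl.
have trE v : tr v \subset E.
  by apply: subset_trans (subsetUr _ _); apply: (bigcup_sup v).
suff partial s : uniq s -> colorable R (base :|: \bigcup_(v <- s) tr v) p.
  have := partial (enum G) (enum_uniq G).
  by rewrite big_enum.
elim: s => [_|v s IHs /= /andP[vs uniq_s]].
  rewrite big_nil setU0.
  (* Pulling back along a retraction onto the base transports the colouring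
     of [G] forward to its copy, with no case distinction on weights. *)
  pose retr (x : attach_vertex T) : G := tag x.
  have retrK (A : {set G}) : retr @: (in_base r @: A) = A.
    by rewrite -imset_comp -[RHS]imset_id.
  apply: (colorable_pullback (f := retr)) colG => [A B|A].
    move=> /imsetP[A' _ ->] /imsetP[B' _ ->] /=.
    by rewrite !retrK => ->.
  by move=> /imsetP[A' A'E ->]; rewrite retrK.
rewrite big_cons setUA setUAC.
apply: (colorable_tree (E := E) (r := r v)) (IHs uniq_s) => //.
- exact: in_tree_inj.
- move=> x xr; apply/setP => B; rewrite in_set0 inE.
  apply/negP => /andP[/setUP[/imsetP[A _ ->] /imsetP[u _] uE|]].
    have uv : v = u := congr1 tag uE; subst u.
    by move/in_tree_inj: uE xr => ->; rewrite eqxx.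
  rewrite bigcup_seq => /bigcupP[u us /imsetP[A _ ->]] /imsetP[y _ yE].
  have uv : v = u := congr1 tag yE.
  by rewrite uv us in vs.
- rewrite subUset baseE bigcup_seq /=; apply/bigcupsP => u _.
  exact: trE.
- exact: trE.
Qed.

End Attach.

(** * Subgraphs and isomorphisms *)

Lemma colorable_hom R (G H : sgraph) (f : G -> H) p :
  injective f -> (forall u v, adj u v -> adj (f u) (f v)) ->
  colorable R (edges H) p -> colorable R (edges G) p.
Proof.
move=> f_inj f_hom; apply: colorable_pullback => [A B _ _|A].
  exact: (imset_inj f_inj).
by case/edgeP => u [v [_ -> /f_hom]]; rewrite imset_pair.
Qed.

Lemma pmd_hom R (G H : sgraph) (f : G -> H) :
  injective f -> (forall u v, adj u v -> adj (f u) (f v)) -> pmd R G <= pmd R H.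
Proof.
by move=> f_inj f_hom; apply/pmd_leP; apply: colorable_hom f_hom _ => //; apply/pmd_leP.
Qed.

Lemma max_valency_hom (G H : sgraph) (f : G -> H) :
  injective f -> (forall u v, adj u v -> adj (f u) (f v)) ->
  max_valency G <= max_valency H.
Proof.
move=> f_inj f_hom; apply/bigmax_leqP => v _.
apply: leq_trans (valency_le_max (f v)).
rewrite /valency -(card_imset _ f_inj); apply: subset_leq_card.
by apply/subsetP => _ /imsetP[u + ->]; rewrite !inE; apply: f_hom.
Qed.

Theorem theorem2p3 (R : realType) (G G' : sgraph) :
  graph_connected G -> antler_graph G G' ->
  pmd R G' = maxn (pmd R G) (max_valency G').
Proof.
move=> _ [T [r [treeT [f [g fK gK] f_adj]]]].
have f_inj := can_inj fK; have g_inj := can_inj gK.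
have f_hom u v : adj u v -> adj (f u) (f v) by rewrite f_adj.
have g_hom u v : adj u v -> adj (g u) (g v) by rewrite -f_adj !gK.
have base_hom u v : adj u v -> @adj (attach r) (in_base r u) (in_base r v).
  move=> uv; apply/setUP; left; apply/imsetP; exists [set u; v] => //.
  by rewrite imset_pair.
apply/eqP; rewrite eqn_leq geq_max; apply/and3P; split.
- apply/pmd_leP; apply: (colorable_hom g_inj g_hom).
  apply: colorable_attach => //.
    exact: leq_trans (max_valency_hom f_inj f_hom) (leq_maxr _ _).
  by apply/pmd_leP; apply: leq_maxl.
- apply: leq_trans (pmd_hom R f_inj f_hom).
  exact: (pmd_hom (H := attach r) R (@in_base_inj G T r) base_hom).
- by apply: (@max_valency_le_colors R); apply/pmd_leP.
Qed.
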